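(* Let $G$ be a commutative group and let $h\colon R\to S$ be a morphism of $G$-graded commutative rings. There is an isomorphism of functors $h^*\cong\widetilde h$ (from $\mathrm{Mod}^G(R)$ to $\mathrm{Mod}^G(S)$) if and only if the $G$-graded $R$-module $h_*(S)$ is projective and of finite type and $\widetilde h(R)\cong S$ in $\mathrm{Mod}^G(S)$.
   Context: All groups and rings are commutative (rings unital). $\mathrm{Mod}^G(R)$ is the category of $G$-graded $R$-modules with degree-preserving $R$-linear maps; $M(g)$ is the shift, $M(g)_{g'}=M_{g+g'}$. The tensor product $M\otimes_RN$ is graded with $x\otimes y$ in degree $\deg x+\deg y$. $\mathrm{Hom}^G_R(M,N)=\bigoplus_{g\in G}\mathrm{Hom}_{\mathrm{Mod}^G(R)}(M,N(g))$, a $G$-graded $R$-module. $h_*\colon\mathrm{Mod}^G(S)\to\mathrm{Mod}^G(R)$ is restriction of scalars along $h$. $h^*(M)=S\otimes_RM$ (the graded tensor product $h_*(S)\otimes_RM$ with $s(t\otimes x)=(st)\otimes x$). $\widetilde h(M)=\mathrm{Hom}^G_R(h_*(S),M)$ with $S$-action $(su)(t)=u(st)$. A $G$-graded $R$-module $M$ is of finite type if there is an epimorphism $L\to M$ in $\mathrm{Mod}^G(R)$ with $L\cong\bigoplus_{i\in I}R(g_i)$ for a finite family $(g_i)_{i\in I}$ in $G$; it is projective if $\mathrm{Hom}_{\mathrm{Mod}^G(R)}(M,\bullet)$ is exact. *)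

(* Defs.v *)
From HB Require Import structures.
From mathcomp Require Import all_boot all_algebra.
From mathcomp Require Import boolp classical_sets functions.

Set Implicit Arguments.
Unset Strict Implicit.
Unset Printing Implicit Defensive.

Import GRing.Theory.
Local Open Scope ring_scope.
Local Open Scope quotient_scope.

(* Gradings are internal: [P g x] means that x is homogeneous of degree g, and
   [is_grading P] says that the zmodType M is the direct sum of the subgroups
   [P g].  In a graded ring, 1 is automatically of degree 0, so [gr_rdeg1] below
   is no restriction.  Rings may be zero, hence comPzRingType. *)
Section Gradings.
Context {G : zmodType}.

Definition gspan (M : zmodType) (P : G -> M -> Prop) (x : M) : Prop :=
  exists (s : seq G) (c : G -> M),
    (forall g, P g (c g)) /\ x = \sum_(g <- s) c g.

Record is_grading (M : zmodType) (P : G -> M -> Prop) : Prop := IsGrading {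
  grading0 : forall g, P g 0;
  gradingB : forall g x y, P g x -> P g y -> P g (x - y);
  grading_span : forall x, gspan P x;
  grading_indep : forall (s : seq G) (c : G -> M), uniq s ->
    (forall g, P g (c g)) -> \sum_(g <- s) c g = 0 ->
    forall g, g \in s -> c g = 0 }.

Section Theory.
Variables (M : zmodType) (P : G -> M -> Prop).

Lemma gspan_sub (K : M -> Prop) :
  K 0 -> (forall x y, K x -> K y -> K (x + y)) ->
  (forall g x, P g x -> K x) -> forall x, gspan P x -> K x.
Proof.
move=> K0 KD KP x [s [c [Pc ->]]].
by elim/big_ind: _ => // g _; apply: KP (Pc g).
Qed.

Hypothesis P0 : forall g, P g 0.
Hypothesis PB : forall g x y, P g x -> P g y -> P g (x - y).

Let PN g x : P g x -> P g (- x).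
Proof. by move=> Px; rewrite -sub0r; apply: PB. Qed.

Let PD g x y : P g x -> P g y -> P g (x + y).
Proof. by move=> Px Py; rewrite -[y]opprK; apply: PB (PN _). Qed.

Definition decomp (x : M) (c : G -> M) : Prop :=
  exists s : seq G, [/\ uniq s, forall g, P g (c g),
    forall g, g \notin s -> c g = 0 & x = \sum_(g <- s) c g].

Lemma big_supp (s t : seq G) (F : G -> M) :
  uniq s -> uniq t -> (forall g, g \notin s -> F g = 0) ->
  (forall g, g \notin t -> F g = 0) -> \sum_(g <- s) F g = \sum_(g <- t) F g.
Proof.
move=> us ut Fs Ft.
have aux (u v : seq G) : (forall g, g \notin v -> F g = 0) ->
    \sum_(g <- u) F g = \sum_(g <- [seq g <- u | g \in v]) F g.
  move=> Fv; rewrite big_filter (bigID [in v]) /= [X in _ + X]big1 ?addr0 //.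
rewrite (aux s t) // (aux t s) //; apply: perm_big.
apply: uniq_perm; rewrite ?filter_uniq // => g.
by rewrite !mem_filter andbC.
Qed.

Lemma decompD x y c d :
  decomp x c -> decomp y d -> decomp (x + y) (fun g => c g + d g).
Proof.
move=> [s [us Pc c0 ->]] [t [ut Pd d0 ->]].
have uu := undup_uniq (s ++ t).
exists (undup (s ++ t)); split=> //.
- by move=> g; apply: PD.
- by move=> g; rewrite mem_undup mem_cat negb_or => /andP[/c0 -> /d0 ->]; rewrite addr0.
rewrite big_split /= (big_supp us uu) ?(big_supp ut uu) // => g.
  by rewrite mem_undup mem_cat negb_or => /andP[_ /d0 ->].
by rewrite mem_undup mem_cat negb_or => /andP[/c0 ->].
Qed.

Lemma decomp0 : decomp 0 (fun=> 0).
Proof. by exists [::]; split=> //; rewrite big_nil. Qed.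

Lemma decomp1 g x : P g x -> decomp x (fun k => if k == g then x else 0).
Proof.
move=> Px; exists [:: g]; split=> //.
- by move=> k; case: eqP => [->|].
- by move=> k; rewrite inE => /negbTE ->.
by rewrite big_seq1 eqxx.
Qed.

Lemma decomp_gspan x : gspan P x -> exists c, decomp x c.
Proof.
apply: (gspan_sub (K := fun x => exists c, decomp x c)).
- by eexists; apply: decomp0.
- by move=> y z [c yc] [d zd]; eexists; apply: decompD yc zd.
- by move=> g y Py; eexists; apply: decomp1 Py.
Qed.

Lemma gspanD x y : gspan P x -> gspan P y -> gspan P (x + y).
Proof.
move=> /decomp_gspan[c xc] /decomp_gspan[d yd].
by have [s [_ ? _ ->]] := decompD xc yd; exists s, (fun g => c g + d g).
Qed.

Lemma gspan1 g x : P g x -> gspan P x.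
Proof.
by move=> /decomp1[s [_ Pc _ ->]]; exists s, (fun k => if k == g then x else 0).
Qed.

Lemma gspan0 : gspan P 0.
Proof. exact: gspan1 (P0 0). Qed.

Lemma gspanN x : gspan P x -> gspan P (- x).
Proof.
move=> [s [c [Pc ->]]]; exists s, (fun g => - c g); split=> [g|].
  exact: PN.
by rewrite sumrN.
Qed.
End Theory.

Section Components.
Variables (M : zmodType) (P : G -> M -> Prop) (grP : is_grading P).

Lemma grading_ind (K : M -> Prop) :
  K 0 -> (forall x y, K x -> K y -> K (x + y)) ->
  (forall g x, P g x -> K x) -> forall x, K x.
Proof.
by move=> K0 KD KP x; apply: (gspan_sub K0 KD KP); apply: (grading_span grP).
Qed.

Lemma gradingD g x y : P g x -> P g y -> P g (x + y).
Proof.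
move=> Px Py; rewrite -[y]opprK; apply: (gradingB grP) => //.
by rewrite -sub0r; apply: (gradingB grP) => //; apply: (grading0 grP).
Qed.

Lemma decomp_uniq x c d : decomp P x c -> decomp P x d -> c =1 d.
Proof.
move=> [s [us Pc c0 xc]] [t [ut Pd d0 xd]] g.
have uu := undup_uniq (s ++ t).
have e0 : \sum_(g <- undup (s ++ t)) (c g - d g) = 0.
  rewrite sumrB -(@big_supp _ s _ c us uu) // -?(@big_supp _ t _ d ut uu) //.
  - by rewrite -xc -xd subrr.
  - by move=> k; rewrite mem_undup mem_cat negb_or => /andP[_ /d0].
  by move=> k; rewrite mem_undup mem_cat negb_or => /andP[/c0].
apply/eqP; rewrite -subr_eq0; apply/eqP.
have [gu|] := boolP (g \in undup (s ++ t)).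
  apply: (grading_indep grP uu _ e0) => // k; exact: (gradingB grP).
by rewrite mem_undup mem_cat negb_or => /andP[/c0 -> /d0 ->]; rewrite subrr.
Qed.

Let decomp_ex x : exists c, decomp P x c.
Proof.
apply: decomp_gspan (grading_span grP x);
  [exact: (grading0 grP) | exact: (gradingB grP)].
Qed.

(* The homogeneous component of x of degree g. *)
Definition gdec (x : M) : G -> M := sval (cid (decomp_ex x)).

Lemma gdecP x : decomp P x (gdec x).
Proof. by rewrite /gdec; case: cid. Qed.

Lemma gdec_homo g x k : P g x -> gdec x k = if k == g then x else 0.
Proof.
move=> Px; exact: (decomp_uniq (gdecP x) (decomp1 (grading0 grP) Px)).
Qed.

Lemma gdecD x y g : gdec (x + y) g = gdec x g + gdec y g.
Proof.
have xy := decompD (grading0 grP) (@gradingB _ _ grP) (gdecP x) (gdecP y).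
exact: (decomp_uniq (gdecP (x + y)) xy).
Qed.

Lemma gdec0 g : gdec 0 g = 0.
Proof. by rewrite (gdec_homo _ (grading0 grP 0)) if_same. Qed.

Lemma gdec_supp x : exists s : seq G,
  uniq s /\ forall g, g \notin s -> gdec x g = 0.
Proof. by have [s [us _ ? _]] := gdecP x; exists s. Qed.
End Components.
End Gradings.


Record grRing (G : zmodType) := GrRing {
  gr_ring :> comPzRingType;
  gr_rdeg : G -> gr_ring -> Prop;
  gr_rgrading : is_grading gr_rdeg;
  gr_rdeg1 : gr_rdeg 0 1;
  gr_rdegM : forall a b x y,
    gr_rdeg a x -> gr_rdeg b y -> gr_rdeg (a + b) (x * y) }.

Record grRingHom (G : zmodType) (R S : grRing G) := GrRingHom {
  gr_rmorph :> {rmorphism R -> S};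
  gr_rmorph_deg : forall g x, gr_rdeg g x -> gr_rdeg g (gr_rmorph x) }.

Record grMod (G : zmodType) (R : grRing G) := GrMod {
  gr_lmod :> lmodType R;
  gr_deg : G -> gr_lmod -> Prop;
  gr_grading : is_grading gr_deg;
  gr_degZ : forall a b (r : R) x,
    gr_rdeg a r -> gr_deg b x -> gr_deg (a + b) (r *: x) }.
Arguments gr_deg {G R} M g x : rename.

Record grHom (G : zmodType) (R : grRing G) (M N : grMod R) := GrHom {
  gr_fun :> M -> N;
  gr_fun_linear : linear gr_fun;
  gr_fun_deg : forall g x, gr_deg M g x -> gr_deg N g (gr_fun x) }.

HB.instance Definition _ (G : zmodType) (R : grRing G) (M N : grMod R)
  (u : grHom M N) := GRing.isLinear.Build R M N *:%R (gr_fun u) (gr_fun_linear u).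

Section Category.
Variables (G : zmodType) (R : grRing G).
Implicit Types L M N : grMod R.

Lemma grHom_eq M N (u v : grHom M N) : u =1 v -> u = v.
Proof.
case: u v => [u ul ud] [v vl vd] /= /funext uv; subst v.
by congr GrHom; apply: Prop_irrelevance.
Qed.

Lemma id_linear M : linear (fun x : M => x). Proof. by []. Qed.

Definition idHom M : grHom M M :=
  GrHom (@id_linear M) (fun g x Mx => Mx).

Lemma comp_linear L M N (v : grHom M N) (u : grHom L M) :
  linear (fun x => v (u x)).
Proof. by move=> a x y; rewrite !linearP. Qed.

Definition compHom L M N (v : grHom M N) (u : grHom L M) : grHom L N :=
  GrHom (@comp_linear L M N v u)
    (fun g x Lx => gr_fun_deg v (gr_fun_deg u Lx)).

Lemma zero_linear M N : linear (fun _ : M => 0 : N).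
Proof. by move=> a x y; rewrite scaler0 addr0. Qed.

Definition zeroHom M N : grHom M N :=
  GrHom (@zero_linear M N) (fun g x _ => grading0 (gr_grading N) g).

Definition gr_is_iso M N (u : grHom M N) : Prop :=
  exists v : grHom N M, compHom v u = idHom M /\ compHom u v = idHom N.

Definition gr_isomorphic M N : Prop := exists u : grHom M N, gr_is_iso u.

Definition gr_is_epi M N (u : grHom M N) : Prop :=
  forall (Q : grMod R) (v w : grHom N Q), compHom v u = compHom w u -> v = w.

Definition gr_short_exact L M N (f : grHom L M) (g : grHom M N) : Prop :=
  [/\ injective f,
      forall y, g y = 0 <-> exists x, y = f x
    & forall z, exists y, z = g y].

(* Exactness of the functor Hom(M, -) : it maps short exact sequences
   0 -> A -> B -> C -> 0 to short exact sequences of groups. *)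
Definition gr_projective M : Prop :=
  forall (A B C : grMod R) (f : grHom A B) (g : grHom B C), gr_short_exact f g ->
  [/\ injective (fun u : grHom M A => compHom f u),
      forall v : grHom M B, compHom g v = zeroHom M C <->
        exists u : grHom M A, v = compHom f u
    & forall w : grHom M C, exists v : grHom M B, w = compHom g v].

Lemma shift_grading M (g : G) : is_grading (fun k x => gr_deg M (g + k) x).
Proof.
have grM := gr_grading M; split.
- by move=> k; apply: (grading0 grM).
- by move=> k x y; apply: (gradingB grM).
- move=> x; have [s [c [Pc ->]]] := grading_span grM x.
  exists [seq k - g | k <- s], (fun k => c (g + k)); split=> //.
  by rewrite big_map; apply: eq_bigr => k _; rewrite addrC subrK.
move=> s c us Pc c0 k ks.
have := @grading_indep _ _ _ grM [seq g + k | k <- s] (fun k => c (k - g)).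
move=> /(_ _ _ _ (g + k)); rewrite addrAC subrr add0r; apply.
- by rewrite map_inj_uniq //; apply: addrI.
- by move=> j; have := Pc (j - g); rewrite addrC subrK.
- by rewrite big_map -[RHS]c0; apply: eq_bigr => j _; rewrite addrAC subrr add0r.
by rewrite mem_map //; apply: addrI.
Qed.

Lemma shift_degZ M (g : G) a b (r : R) (x : M) :
  gr_rdeg a r -> gr_deg M (g + b) x -> gr_deg M (g + (a + b)) (r *: x).
Proof. by move=> ra xb; rewrite addrCA; apply: gr_degZ. Qed.

Definition gr_shift M (g : G) : grMod R :=
  GrMod (shift_grading M g) (@shift_degZ M g).

Definition gr_reg : grMod R :=
  @GrMod G R R^o (@gr_rdeg G R) (gr_rgrading R) (@gr_rdegM G R).

Section Free.
Variables (I : finType) (g : I -> G).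

Definition free_deg (k : G) (x : {ffun I -> R^o}) : Prop :=
  forall i, gr_deg (gr_shift gr_reg (g i)) k (x i).

Lemma free_grading : is_grading free_deg.
Proof.
have grS i := gr_grading (gr_shift gr_reg (g i)).
have fd0 k : free_deg k 0 by move=> i; rewrite ffunE; apply: (grading0 (grS i)).
have fdB k x y : free_deg k x -> free_deg k y -> free_deg k (x - y).
  by move=> xk yk i; rewrite !ffunE; apply: (gradingB (grS i)).
split=> //.
- move=> x; pose d (i : I) (r : R^o) : {ffun I -> R^o} :=
    [ffun j => if j == i then r else 0].
  have dsp i r : gspan free_deg (d i r).
    apply: (grading_ind (grS i) (K := fun r => gspan free_deg (d i r))).
    + suff -> : d i 0 = 0 by apply: gspan0.
      by apply/ffunP => j; rewrite !ffunE if_same.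
    + move=> y z dy dz; suff -> : d i (y + z) = d i y + d i z by apply: gspanD.
      by apply/ffunP => j; rewrite !ffunE; case: eqP => // _; rewrite addr0.
    + move=> k y ky; apply: (gspan1 fd0 (g := k)) => j; rewrite ffunE.
      by case: eqP => [->//|_]; apply: (grading0 (grS j)).
  have -> : x = \sum_i d i (x i).
    apply/ffunP => j; rewrite sum_ffunE (bigD1 j) //= ffunE eqxx big1 ?addr0 //.
    by move=> i ij; rewrite ffunE eq_sym (negbTE ij).
  by elim/big_ind: _ => //; [apply: gspan0 | move=> *; apply: gspanD].
move=> s c us Pc c0 k ks; apply/ffunP => i; rewrite ffunE.
apply: (grading_indep (grS i) (c := fun k => c k i) us) => //.
  by move=> j; apply: Pc.
by have := congr1 (fun z : {ffun I -> R^o} => z i) c0; rewrite sum_ffunE ffunE.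
Qed.

Lemma free_degZ a b (r : R) (x : {ffun I -> R^o}) :
  gr_rdeg a r -> free_deg b x -> free_deg (a + b) (r *: x).
Proof. by move=> ra xb i; rewrite ffunE; apply: (gr_degZ ra (xb i)). Qed.

(* The direct sum of the R(g i), i in I. *)
Definition gr_free : grMod R := GrMod free_grading free_degZ.
End Free.

Definition gr_finite_type M : Prop :=
  exists (I : finType) (g : I -> G) (L : grMod R) (u : grHom L M),
    gr_isomorphic L (gr_free g) /\ gr_is_epi u.
End Category.

Record grFunctor (G : zmodType) (R S : grRing G) := GrFunctor {
  fobj :> grMod R -> grMod S;
  fmap : forall M N : grMod R, grHom M N -> grHom (fobj M) (fobj N);
  fmap_id : forall M, fmap (idHom M) = idHom (fobj M);
  fmap_comp : forall L M N (v : grHom M N) (u : grHom L M),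
    fmap (compHom v u) = compHom (fmap v) (fmap u) }.

Definition functors_isomorphic (G : zmodType) (R S : grRing G)
    (F F' : grFunctor R S) : Prop :=
  exists phi : forall M : grMod R, grHom (F M) (F' M),
    (forall M, gr_is_iso (phi M)) /\
    (forall (M N : grMod R) (u : grHom M N),
       compHom (phi N) (fmap F u) = compHom (fmap F' u) (phi M)).

(* The tensor product over a commutative ring: formal sums of pairs, two of
   them being identified when all balanced biadditive maps to abelian groups
   take the same value on them.  Its universal property is given by
   [tens_balanced], [tliftD], [tlift_tens] and [tlift_unique] (for balanced
   maps), [tens_bilinear] and [tlift_linear] (for bilinear maps). *)
Section Tensor.
Variables (R : comPzRingType) (M N : lmodType R).

Record balanced (A : zmodType) (b : M -> N -> A) : Prop := Balanced {
  balancedDl : forall y x x', b (x + x') y = b x y + b x' y;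
  balancedDr : forall x y y', b x (y + y') = b x y + b x y';
  balancedZ : forall r x y, b (r *: x) y = b x (r *: y) }.

Definition tval (A : zmodType) (b : M -> N -> A) (l : seq (M * N)) : A :=
  \sum_(p <- l) b p.1 p.2.

Definition trel (l m : seq (M * N)) : bool :=
  `[< forall (A : zmodType) (b : M -> N -> A), balanced b ->
      tval b l = tval b m >].

Lemma trel_equiv : equiv_class_of trel.
Proof.
split.
- by move=> l; apply/asboolP.
- by move=> l m; apply/asboolP/asboolP => e A b bb; rewrite e.
move=> l m n /asboolP e /asboolP f.
by apply/asboolP => A b bb; rewrite e // f.
Qed.

Canonical trel_equivRel := EquivRelPack trel_equiv.

Definition tensor : Type := {eq_quot trel_equivRel}.
HB.instance Definition _ := Choice.on tensor.
HB.instance Definition _ := EqQuotient.on tensor.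

Definition tclass (l : seq (M * N)) : tensor := \pi_tensor l.

(* The common value of [tval b] on the representatives of z. *)
Definition tlift (A : zmodType) (b : M -> N -> A) (z : tensor) : A :=
  tval b (repr z).

Lemma tlift_class A b l : @balanced A b -> tlift b (tclass l) = tval b l.
Proof.
move=> bb; rewrite /tlift /tclass.
have /eqmodP/asboolP : repr (\pi_tensor l) = l %[mod tensor] by rewrite reprK.
exact.
Qed.

Lemma tensor_eq (z w : tensor) :
  (forall (A : zmodType) (b : M -> N -> A), balanced b ->
     tlift b z = tlift b w) -> z = w.
Proof.
move=> e; rewrite -[z]reprK -[w]reprK; apply/eqmodP/asboolP => A b bb.
exact: e.
Qed.

Lemma balanced0l A b : @balanced A b -> forall y, b 0 y = 0.
Proof.
by move=> bb y; apply: (addrI (b 0 y)); rewrite -(balancedDl bb) !addr0.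
Qed.

Lemma balanced0r A b : @balanced A b -> forall x, b x 0 = 0.
Proof.
by move=> bb x; apply: (addrI (b x 0)); rewrite -(balancedDr bb) !addr0.
Qed.

Lemma balancedNl A b : @balanced A b -> forall x y, b (- x) y = - b x y.
Proof.
move=> bb x y; apply: (addrI (b x y)).
by rewrite -(balancedDl bb) !subrr (balanced0l bb).
Qed.

Lemma balanced_scale r A b : @balanced A b -> balanced (fun x => b (r *: x)).
Proof.
move=> bb; split.
- by move=> y x x'; rewrite scalerDr (balancedDl bb).
- by move=> x y y'; rewrite (balancedDr bb).
by move=> s x y; rewrite scalerA mulrC -scalerA (balancedZ bb).
Qed.

Definition tadd (z w : tensor) : tensor := tclass (repr z ++ repr w).
Definition tzero : tensor := tclass [::].
Definition topp (z : tensor) : tensor :=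
  tclass [seq (- p.1, p.2) | p <- repr z].
Definition tscale (r : R) (z : tensor) : tensor :=
  tclass [seq (r *: p.1, p.2) | p <- repr z].

Lemma tlift_add A b z w : @balanced A b ->
  tlift b (tadd z w) = tlift b z + tlift b w.
Proof. by move=> bb; rewrite tlift_class // /tval big_cat. Qed.

Lemma tlift_zero A b : @balanced A b -> tlift b tzero = 0.
Proof. by move=> bb; rewrite tlift_class // /tval big_nil. Qed.

Lemma tlift_opp A b z : @balanced A b -> tlift b (topp z) = - tlift b z.
Proof.
move=> bb; rewrite tlift_class // /tlift /tval big_map -sumrN.
by apply: eq_bigr => p _ /=; rewrite balancedNl.
Qed.

Lemma tlift_scale A b r z : @balanced A b ->
  tlift b (tscale r z) = tlift (fun x => b (r *: x)) z.
Proof. by move=> bb; rewrite tlift_class // /tlift /tval big_map. Qed.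

Lemma taddA : associative tadd.
Proof. by move=> x y z; apply: tensor_eq => A b bb; rewrite !tlift_add // addrA. Qed.
Lemma taddC : commutative tadd.
Proof. by move=> x y; apply: tensor_eq => A b bb; rewrite !tlift_add // addrC. Qed.
Lemma tadd0 : left_id tzero tadd.
Proof.
by move=> x; apply: tensor_eq => A b bb; rewrite tlift_add // tlift_zero // add0r.
Qed.
Lemma taddN : left_inverse tzero topp tadd.
Proof.
move=> x; apply: tensor_eq => A b bb.
by rewrite tlift_add // tlift_opp // tlift_zero // addNr.
Qed.

HB.instance Definition _ := GRing.isZmodule.Build tensor taddA taddC tadd0 taddN.

Lemma tliftD A b (z w : tensor) : @balanced A b ->
  tlift b (z + w) = tlift b z + tlift b w.
Proof. exact: tlift_add. Qed.

Lemma tlift0 A b : @balanced A b -> tlift b 0 = 0.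
Proof. exact: tlift_zero. Qed.

Lemma tlift_sum (A : zmodType) (b b' : M -> N -> A) z :
  tlift (fun x y => b x y + b' x y) z = tlift b z + tlift b' z.
Proof. exact: big_split. Qed.

Lemma eq_tlift (A : zmodType) (b b' : M -> N -> A) z :
  (forall x y, b x y = b' x y) -> tlift b z = tlift b' z.
Proof. by move=> e; apply: eq_bigr => p _; apply: e. Qed.

Lemma tscaleA r s z : tscale r (tscale s z) = tscale (r * s) z.
Proof.
apply: tensor_eq => A b bb; rewrite !tlift_scale //; last exact: balanced_scale.
by apply: eq_tlift => x y; rewrite scalerA.
Qed.
Lemma tscale1 : left_id 1 tscale.
Proof.
move=> z; apply: tensor_eq => A b bb; rewrite tlift_scale //.
by apply: eq_tlift => x y; rewrite scale1r.
Qed.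
Lemma tscaleDr : right_distributive tscale +%R.
Proof.
move=> r x y; apply: tensor_eq => A b bb.
by rewrite tliftD // !tlift_scale // tliftD //; apply: balanced_scale.
Qed.
Lemma tscaleDl z : {morph tscale^~ z : r s / r + s}.
Proof.
move=> r s; apply: tensor_eq => A b bb.
rewrite tliftD // !tlift_scale // -tlift_sum; apply: eq_tlift => x y.
by rewrite scalerDl (balancedDl bb).
Qed.

HB.instance Definition _ := GRing.Zmodule_isLmodule.Build R tensor
  tscaleA tscale1 tscaleDr tscaleDl.

Definition tens (x : M) (y : N) : tensor := tclass [:: (x, y)].

Lemma tlift_tens A b x y : @balanced A b -> tlift b (tens x y) = b x y.
Proof. by move=> bb; rewrite tlift_class // /tval big_seq1. Qed.

Lemma tlift_tscale A b r (z : tensor) : @balanced A b ->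
  tlift b (r *: z) = tlift (fun x => b (r *: x)) z.
Proof. exact: tlift_scale. Qed.

Lemma tens_balanced : balanced tens.
Proof.
split; intros; apply: tensor_eq => A b bb; rewrite ?tliftD // !tlift_tens //.
- exact: balancedDl.
- exact: balancedDr.
- exact: balancedZ.
Qed.

Lemma tensZl r x y : tens (r *: x) y = r *: tens x y.
Proof.
apply: tensor_eq => A b bb.
by rewrite tlift_tscale // !tlift_tens //; apply: balanced_scale.
Qed.

Lemma tensZr r x y : tens x (r *: y) = r *: tens x y.
Proof. by rewrite -(balancedZ tens_balanced) tensZl. Qed.

Lemma tens_bilinear : (forall y, linear (tens^~ y)) /\ (forall x, linear (tens x)).
Proof.
split=> [y|x] r u v.
  by rewrite (balancedDl tens_balanced) tensZl.
by rewrite (balancedDr tens_balanced) tensZr.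
Qed.

Lemma tlift_linear (P : lmodType R) (b : M -> N -> P) : balanced b ->
  (forall r x y, b (r *: x) y = r *: b x y) -> linear (tlift b).
Proof.
move=> bb bZ r z w; rewrite tliftD // tlift_tscale //; congr (_ + _).
by rewrite /tlift /tval scaler_sumr; apply: eq_bigr => p _; apply: bZ.
Qed.

Lemma tensor_ind (K : tensor -> Prop) :
  K 0 -> (forall x y z, K z -> K (tens x y + z)) -> forall z, K z.
Proof.
move=> K0 KD z; rewrite -[z]reprK; elim: (repr z) => [|[x y] l IHl] //.
suff -> : \pi_tensor ((x, y) :: l) = tens x y + tclass l by apply: KD.
apply: tensor_eq => A b bb.
by rewrite tliftD // tlift_tens // !tlift_class // /tval big_cons.
Qed.

Lemma tlift_unique (A : zmodType) b (f : tensor -> A) : balanced b ->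
  (forall z w, f (z + w) = f z + f w) ->
  (forall x y, f (tens x y) = b x y) -> f =1 tlift b.
Proof.
move=> bb fD fb.
have f0 : f 0 = 0 by apply: (addrI (f 0)); rewrite -fD !addr0.
apply: tensor_ind => [|x y z IHz]; first by rewrite f0 tlift0.
by rewrite fD IHz fb tliftD // tlift_tens.
Qed.
End Tensor.

Section GradedTensor.
Variables (G : zmodType) (R : grRing G) (M N : grMod R).

(* The subgroup generated by the x (x) y with deg x + deg y = d; it is closed
   under opposite because - (x (x) y) = (- x) (x) y. *)
Inductive tensor_deg (d : G) : tensor M N -> Prop :=
| TensorDeg0 : tensor_deg d 0
| TensorDegD a b x y z : gr_deg M a x -> gr_deg N b y -> a + b = d ->
    tensor_deg d z -> tensor_deg d (tens x y + z).

Let bT : balanced (@tens R M N) := tens_balanced M N.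

Lemma tensor_deg_tens a b x y :
  gr_deg M a x -> gr_deg N b y -> tensor_deg (a + b) (tens x y).
Proof.
by move=> xa yb; rewrite -[tens x y]addr0; apply: TensorDegD xa yb _ (TensorDeg0 _).
Qed.

Lemma tensor_degD d z w : tensor_deg d z -> tensor_deg d w -> tensor_deg d (z + w).
Proof.
move=> zd; elim: zd w => [w wd|a b x y {}z xa yb ab zd IHz w wd]; rewrite ?add0r //.
by rewrite -addrA; apply: (TensorDegD xa yb ab); apply: IHz.
Qed.

Lemma tensor_degN d z : tensor_deg d z -> tensor_deg d (- z).
Proof.
elim=> [|a b x y {}z xa yb ab zd IHz]; first by rewrite oppr0; constructor.
rewrite opprD -(balancedNl bT); apply: (TensorDegD _ yb ab IHz).
rewrite -sub0r; apply: (gradingB (gr_grading M)) => //.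
exact: (grading0 (gr_grading M)).
Qed.

Let dM := gdec (gr_grading M).
Let dN := gdec (gr_grading N).

Let supp (x : M) : seq G := sval (cid (gdec_supp (gr_grading M) x)).
Let suppP x : uniq (supp x) /\ forall g, g \notin supp x -> dM x g = 0.
Proof. by rewrite /supp; case: cid. Qed.

(* The component of degree d of x (x) y. *)
Let B (d : G) (x : M) (y : N) : tensor M N :=
  \sum_(g <- supp x) tens (dM x g) (dN y (d - g)).

Let B_supp d x y s : uniq s -> (forall g, g \notin s -> dM x g = 0) ->
  B d x y = \sum_(g <- s) tens (dM x g) (dN y (d - g)).
Proof.
move=> us x0; have [ux ux0] := suppP x.
by apply: big_supp => // g; [move=> /ux0 -> | move=> /x0 ->]; rewrite (balanced0l bT).
Qed.

Let B_addl d y x x' : B d (x + x') y = B d x y + B d x' y.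
Proof.
have [ux ux0] := suppP x; have [ux' ux0'] := suppP x'.
have uu := undup_uniq (supp x ++ supp x').
rewrite !(@B_supp _ _ _ (undup (supp x ++ supp x'))) //; first last.
- move=> g; rewrite mem_undup mem_cat negb_or => /andP[/ux0 e /ux0' e'].
  by rewrite /dM gdecD -/dM e e' addr0.
- by move=> g; rewrite mem_undup mem_cat negb_or => /andP[/ux0].
- by move=> g; rewrite mem_undup mem_cat negb_or => /andP[_ /ux0'].
rewrite -big_split; apply: eq_bigr => g _.
by rewrite /dM gdecD (balancedDl bT).
Qed.

Let B_addr d x y y' : B d x (y + y') = B d x y + B d x y'.
Proof.
rewrite -big_split; apply: eq_bigr => g _.
by rewrite /dN gdecD (balancedDr bT).
Qed.

Let B_0l d y : B d 0 y = 0.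
Proof. by apply: (addrI (B d 0 y)); rewrite -B_addl !addr0. Qed.
Let B_0r d x : B d x 0 = 0.
Proof. by apply: (addrI (B d x 0)); rewrite -B_addr !addr0. Qed.

Let B_homo d a b x y : gr_deg M a x -> gr_deg N b y ->
  B d x y = if a + b == d then tens x y else 0.
Proof.
move=> xa yb; rewrite (@B_supp _ _ _ [:: a]) //; last first.
  by move=> g; rewrite inE /dM (gdec_homo _ _ xa) => /negbTE ->.
rewrite big_seq1 /dM (gdec_homo _ _ xa) eqxx /dN (gdec_homo _ _ yb).
rewrite subr_eq [b + a]addrC [d == _]eq_sym.
by case: ifP; rewrite ?(balanced0r bT).
Qed.

Let B_balanced d : balanced (B d).
Proof.
split; [exact: B_addl | exact: B_addr |].
elim/(grading_ind (gr_rgrading R)) => [|r s IHr IHs|e r re] x y.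
- by rewrite !scale0r B_0l B_0r.
- by rewrite !scalerDl B_addl B_addr IHr IHs.
elim/(grading_ind (gr_grading M)): x => [|x x' IHx IHx'|a x xa].
- by rewrite scaler0 !B_0l.
- by rewrite scalerDr !B_addl IHx IHx'.
elim/(grading_ind (gr_grading N)): y => [|y y' IHy IHy'|b y yb].
- by rewrite scaler0 !B_0r.
- by rewrite scalerDr !B_addr IHy IHy'.
rewrite (B_homo d (gr_degZ re xa) yb) (B_homo d xa (gr_degZ re yb)).
by rewrite addrCA addrA (balancedZ bT).
Qed.

Let tlift_deg d k z : tensor_deg k z -> tlift (B d) z = if k == d then z else 0.
Proof.
elim=> [|a b x y {}z xa yb <- _ IHz]; first by rewrite tlift0 // if_same.
rewrite tliftD // tlift_tens // IHz (B_homo d xa yb).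
by case: ifP; rewrite ?addr0.
Qed.

Lemma tensor_grading : is_grading tensor_deg.
Proof.
have T0 d : tensor_deg d 0 by constructor.
have TB d z w : tensor_deg d z -> tensor_deg d w -> tensor_deg d (z - w).
  by move=> zd wd; apply: tensor_degD => //; apply: tensor_degN.
have sD := gspanD T0 TB; have s0 := gspan0 T0.
split=> //.
- apply: tensor_ind => // x y z IHz; apply: (sD) => // {z IHz}.
  elim/(grading_ind (gr_grading M)): x => [|x x' IHx IHx'|a x xa].
  + by rewrite (balanced0l bT).
  + by rewrite (balancedDl bT); apply: sD.
  elim/(grading_ind (gr_grading N)): y => [|y y' IHy IHy'|b y yb].
  + by rewrite (balanced0r bT).
  + by rewrite (balancedDr bT); apply: sD.
  by apply: (gspan1 T0 (g := a + b)); apply: tensor_deg_tens.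
move=> s c us Tc c0 k ks.
have lB d (I : Type) (r : seq I) (F : I -> tensor M N) :
    tlift (B d) (\sum_(i <- r) F i) = \sum_(i <- r) tlift (B d) (F i).
  by elim/big_rec2: _ => [|i y1 y2 _ <-]; rewrite ?tlift0 ?tliftD.
have := lB k _ s c; rewrite c0 tlift0 //.
rewrite (eq_bigr (fun g => if g == k then c k else 0)); last first.
  by move=> g _; rewrite (tlift_deg k (Tc g)); case: eqP => [->|].
by rewrite -big_mkcond -big_filter filter_pred1_uniq // big_seq1.
Qed.
End GradedTensor.

Section Restriction.
Variables (G : zmodType) (R S : grRing G) (h : grRingHom R S).

Definition res_sort (h : grRingHom R S) (M : lmodType S) : Type := M.

Section Module.
Variable M : lmodType S.
HB.instance Definition _ := GRing.Zmodule.on (res_sort h M).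

Definition res_scale (r : R) (x : res_sort h M) : res_sort h M :=
  h r *: (x : M).

Lemma res_scaleA r s x : res_scale r (res_scale s x) = res_scale (r * s) x.
Proof. by rewrite /res_scale rmorphM scalerA. Qed.
Lemma res_scale1 : left_id 1 res_scale.
Proof. by move=> x; rewrite /res_scale rmorph1 scale1r. Qed.
Lemma res_scaleDr : right_distributive res_scale +%R.
Proof. by move=> r x y; apply: (scalerDr (h r : S) (x : M) y). Qed.
Lemma res_scaleDl x : {morph res_scale^~ x : r s / r + s}.
Proof. by move=> r s; rewrite /res_scale rmorphD; apply: (scalerDl (x : M)). Qed.

HB.instance Definition _ := GRing.Zmodule_isLmodule.Build R (res_sort h M)
  res_scaleA res_scale1 res_scaleDr res_scaleDl.
End Module.

Lemma res_degZ (M : grMod S) a b (r : R) (x : res_sort h M) :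
  gr_rdeg a r -> gr_deg M b x -> gr_deg M (a + b) (r *: x).
Proof. by move=> ra xb; apply: (gr_degZ (gr_rmorph_deg h ra) xb). Qed.

(* h_*(M) *)
Definition gr_res (M : grMod S) : grMod R :=
  @GrMod G R (res_sort h M) (gr_deg M) (gr_grading M) (@res_degZ M).
End Restriction.

Section Extension.
Variables (G : zmodType) (R S : grRing G) (h : grRingHom R S).

Local Notation hS := (gr_res h (gr_reg S)).

Definition ext_sort (h : grRingHom R S) (M : grMod R) : Type :=
  tensor (gr_res h (gr_reg S)) M.

Section Module.
Variable M : grMod R.
HB.instance Definition _ := GRing.Zmodule.on (ext_sort h M).

Let bT : balanced (@tens R hS M) := tens_balanced hS M.

Lemma ext_mul_balanced (s : S) :
  balanced (fun (t : hS) (x : M) => tens (s * (t : S) : hS) x).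
Proof.
split.
- by move=> x t t'; rewrite -(balancedDl bT); congr tens; apply: (mulrDr s).
- by move=> t x y; rewrite (balancedDr bT).
move=> r t x; rewrite -(balancedZ bT); congr tens.
exact: (mulrCA s (h r) (t : S)).
Qed.

(* s (t (x) x) = (s t) (x) x *)
Definition ext_scale (s : S) : ext_sort h M -> ext_sort h M :=
  tlift (fun (t : hS) (x : M) => tens (s * (t : S) : hS) x).

Lemma ext_scale_tens s (t : S) (x : M) :
  ext_scale s (tens (t : hS) x) = tens (s * t : hS) x.
Proof. exact: (tlift_tens _ _ (ext_mul_balanced s)). Qed.

Lemma ext_scaleDr : right_distributive ext_scale +%R.
Proof. by move=> s z w; apply: (tliftD _ _ (ext_mul_balanced s)). Qed.

Lemma ext_scale0 s : ext_scale s 0 = 0.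
Proof. exact: (tlift0 (ext_mul_balanced s)). Qed.

Lemma ext_scaleA r s z : ext_scale r (ext_scale s z) = ext_scale (r * s) z.
Proof.
elim/tensor_ind: z => [|t x z IHz]; first by rewrite !ext_scale0.
by rewrite !ext_scaleDr IHz !ext_scale_tens mulrA.
Qed.
Lemma ext_scale1 : left_id 1 ext_scale.
Proof.
elim/tensor_ind => [|t x z IHz]; first by rewrite !ext_scale0.
by rewrite !ext_scaleDr IHz !ext_scale_tens mul1r.
Qed.
Lemma ext_scaleDl z : {morph ext_scale^~ z : r s / r + s}.
Proof.
move=> r s; elim/tensor_ind: z => [|t x z IHz]; first by rewrite !ext_scale0 addr0.
rewrite !ext_scaleDr IHz !ext_scale_tens addrACA; congr (_ + _).
by rewrite -(balancedDl bT); congr tens; apply: mulrDl.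
Qed.

HB.instance Definition _ := GRing.Zmodule_isLmodule.Build S (ext_sort h M)
  ext_scaleA ext_scale1 ext_scaleDr ext_scaleDl.

Lemma ext_degZ a b (s : S) (z : ext_sort h M) :
  gr_rdeg a s -> @tensor_deg G R hS M b z ->
  @tensor_deg G R hS M (a + b) (s *: z).
Proof.
move=> sa; elim=> [|c d t x {}z tc xd <- _ IHz].
  by rewrite [s *: _]ext_scale0; constructor.
rewrite [s *: _]ext_scaleDr; apply: tensor_degD IHz.
rewrite ext_scale_tens addrA; apply: tensor_deg_tens xd.
exact: (@gr_rdegM G S).
Qed.
End Module.

(* h^*(M) *)
Definition gr_ext (M : grMod R) : grMod S :=
  @GrMod G S (ext_sort h M) (@tensor_deg G R hS M) (tensor_grading hS M)
    (@ext_degZ M).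

Section Map.
Variables (M N : grMod R) (u : grHom M N).

Lemma ext_map_balanced : balanced (fun (t : hS) (x : M) => tens t (u x)).
Proof.
have bT : balanced (@tens R hS N) := tens_balanced hS N.
split=> [x t t'|t x y|r t x].
- by rewrite (balancedDl bT).
- by rewrite linearD (balancedDr bT).
by rewrite (balancedZ bT) linearZ.
Qed.

Definition ext_map_fun : gr_ext M -> gr_ext N :=
  tlift (fun (t : hS) (x : M) => tens t (u x)).

Lemma ext_map_tens (t : hS) x : ext_map_fun (tens t x) = tens t (u x).
Proof. exact: (tlift_tens _ _ ext_map_balanced). Qed.

Lemma ext_mapD z w : ext_map_fun (z + w) = ext_map_fun z + ext_map_fun w.
Proof. exact: (tliftD _ _ ext_map_balanced). Qed.

Lemma ext_map0 : ext_map_fun 0 = 0.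
Proof. exact: (tlift0 ext_map_balanced). Qed.

Lemma ext_map_scale s (z : ext_sort h M) :
  ext_map_fun (ext_scale s z) = ext_scale s (ext_map_fun z).
Proof.
elim/tensor_ind: z => [|t x z IHz].
  by rewrite ext_scale0 ext_map0 ext_scale0.
rewrite ext_scaleDr !ext_mapD ext_scaleDr IHz; congr (_ + _).
by rewrite ext_scale_tens !ext_map_tens ext_scale_tens.
Qed.

Lemma ext_map_linear : linear ext_map_fun.
Proof. by move=> s z w; rewrite ext_mapD ext_map_scale. Qed.

Lemma ext_map_deg g z : gr_deg (gr_ext M) g z -> gr_deg (gr_ext N) g (ext_map_fun z).
Proof.
elim=> [|a b t x {}z ta xb ab _ IHz]; first by rewrite ext_map0; constructor.
rewrite ext_mapD ext_map_tens; apply: (TensorDegD ta _ ab IHz).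
exact: gr_fun_deg.
Qed.

Definition ext_map : grHom (gr_ext M) (gr_ext N) := GrHom ext_map_linear ext_map_deg.
End Map.

Lemma ext_map_id M : ext_map (idHom M) = idHom (gr_ext M).
Proof.
apply: grHom_eq; elim/tensor_ind => [|t x z IHz]; first exact: ext_map0.
by rewrite /= ext_mapD ext_map_tens; congr (_ + _); apply: IHz.
Qed.

Lemma ext_map_comp L M N (v : grHom M N) (u : grHom L M) :
  ext_map (compHom v u) = compHom (ext_map v) (ext_map u).
Proof.
apply: grHom_eq; elim/tensor_ind => [|t x z IHz] /=; first by rewrite !ext_map0.
by rewrite !(ext_mapD, ext_map_tens); congr (_ + _); apply: IHz.
Qed.

Definition hstar : grFunctor R S := GrFunctor ext_map_id ext_map_comp.
End Extension.

(* Hom^G_R(M, N): since the sum of the groups Hom(M, N(g)) inside the group of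
   all maps M -> N is direct, it is realized as the group of those maps that are
   finite sums of maps of the form "morphism M -> N(g)". *)
Section GradedHom.
Variables (G : zmodType) (R : grRing G) (M N : grMod R).

Definition map_deg (g : G) (u : M -> N) : Prop :=
  exists v : grHom M (gr_shift N g), u = gr_fun v.

Lemma map_degE g u : map_deg g u <->
  linear u /\ forall d x, gr_deg M d x -> gr_deg N (g + d) (u x).
Proof.
split=> [[v ->]|[ul ud]]; last by exists (@GrHom G R M (gr_shift N g) u ul ud).
by split; [apply: (gr_fun_linear v) | apply: (gr_fun_deg v)].
Qed.

Lemma map_deg0 g : map_deg g 0.
Proof.
apply/map_degE; split=> [a x y|d x _]; first by rewrite scaler0 addr0.
exact: (grading0 (gr_grading N)).
Qed.

Lemma map_degB g u v : map_deg g u -> map_deg g v -> map_deg g (u - v).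
Proof.
move=> /map_degE[ul ud] /map_degE[vl vd]; apply/map_degE; split=> [a x y|d x xd].
  by rewrite !fctE ul vl scalerBr opprD addrACA.
by apply: (gradingB (gr_grading N)); [apply: ud | apply: vd].
Qed.

Definition homG_pred : {pred M -> N} := fun u => `[< gspan map_deg u >].

Lemma homG_zmod_closed : zmod_closed homG_pred.
Proof.
split; first by apply/asboolP; apply: gspan0 map_deg0.
move=> u v us vs; apply/asboolP.
apply: (gspanD map_deg0 map_degB); first exact: asboolW us.
apply: (gspanN map_deg0 map_degB); exact: asboolW vs.
Qed.

HB.instance Definition _ := GRing.isZmodClosed.Build (M -> N) homG_pred
  homG_zmod_closed.

Record homG : Type := HomG { homG_fun :> M -> N; _ : homG_fun \in homG_pred }.

HB.instance Definition _ := [isSub for homG_fun].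
HB.instance Definition _ := [Choice of homG by <:].
HB.instance Definition _ := [SubChoice_isSubZmodule of homG by <:].

Lemma homGP (u : homG) : gspan map_deg u.
Proof. by case: u => u up; apply: asboolW up. Qed.

Lemma homG_linear (u : homG) : linear u.
Proof.
apply: (gspan_sub (K := fun u : M -> N => linear u)) (homGP u).
- by move=> a x y; rewrite scaler0 addr0.
- by move=> v w vl wl a x y; rewrite !fctE vl wl scalerDr addrACA.
by move=> g v /map_degE[].
Qed.

HB.instance Definition _ (u : homG) :=
  GRing.isLinear.Build R M N *:%R (homG_fun u) (homG_linear u).

Lemma homG0 (u : homG) : u 0 = 0. Proof. exact: linear0. Qed.

Lemma homGD (u : homG) x y : u (x + y) = u x + u y.
Proof. exact: linearD. Qed.

Lemma homG_eq (u v : homG) : u =1 v -> u = v.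
Proof. by move=> /funext e; apply: val_inj. Qed.

Definition homG_deg (g : G) (u : homG) : Prop := map_deg g u.

Lemma homG_grading : is_grading homG_deg.
Proof.
split.
- exact: map_deg0.
- by move=> g u v; apply: map_degB.
- move=> [u up]; have [s [c [cP uE]]] := asboolW up.
  have cp g : c g \in homG_pred by apply/asboolP; apply: (gspan1 map_deg0 (cP g)).
  exists s, (fun g => HomG (cp g)); split=> //; apply: val_inj.
  by rewrite raddf_sum.
move=> s c us cP c0 k ks; apply: homG_eq => x.
elim/(grading_ind (gr_grading M)): x => [|x y IHx IHy|d x xd].
- by rewrite homG0.
- by rewrite homGD IHx IHy addr0.
have := @grading_indep _ _ _ (gr_grading N) [seq g + d | g <- s]
  (fun g => c (g - d) x).
move=> /(_ _ _ _ (k + d)); rewrite addrK; apply.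
- by rewrite map_inj_uniq //; apply: addIr.
- by move=> g; have /map_degE[_ /(_ d x xd)] := cP (g - d); rewrite subrK.
- apply: etrans (congr1 (fun u : homG => val u x) c0).
  rewrite big_map raddf_sum fct_sumE.
  by apply: eq_bigr => g _; rewrite addrK.
exact: (map_f (fun g => g + d) ks).
Qed.
End GradedHom.

Section Coextension.
Variables (G : zmodType) (R S : grRing G) (h : grRingHom R S).

Local Notation hS := (gr_res h (gr_reg S)).

Definition coext_sort (h : grRingHom R S) (M : grMod R) : Type :=
  homG (gr_res h (gr_reg S)) M.

Section Module.
Variable M : grMod R.
HB.instance Definition _ := GRing.Zmodule.on (coext_sort h M).

Lemma coext_mul_deg a g (s : S) (u : hS -> M) : gr_rdeg a s ->
  map_deg g u -> map_deg (a + g) (fun t : hS => u (s * (t : S) : hS)).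
Proof.
move=> sa /map_degE[ul ud]; apply/map_degE; split=> [r x y|d t td].
  rewrite -ul; congr u; rewrite mulrDr; congr (_ + _).
  exact: (mulrCA s (h r) (x : S)).
by rewrite [a + g]addrC -addrA; apply: ud; apply: (@gr_rdegM G S).
Qed.

Lemma coext_scale_subproof (s : S) (u : coext_sort h M) :
  (fun t : hS => u (s * (t : S) : hS)) \in @homG_pred G R hS M.
Proof.
have m0 := @map_deg0 G R hS M; have mB := @map_degB G R hS M.
apply/asboolP.
elim/(grading_ind (gr_rgrading S)): s => [|s s' IHs IHs'|a s sa].
- suff -> : (fun t : hS => u (0 * (t : S) : hS)) = 0 by apply: gspan0.
  apply/funext => t; rewrite mul0r.
  exact: homG0.
- suff -> : (fun t : hS => u ((s + s') * (t : S) : hS)) =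
      (fun t : hS => u (s * (t : S) : hS)) + (fun t : hS => u (s' * (t : S) : hS)).
    exact: gspanD.
  apply/funext => t; rewrite mulrDl fctE.
  exact: homGD.
apply: (gspan_sub (K := fun u : hS -> M =>
  gspan (@map_deg G R hS M) (fun t : hS => u (s * (t : S) : hS)))) (homGP u).
- exact: gspan0.
- by move=> v w; apply: gspanD.
by move=> g v vg; apply: gspan1 (coext_mul_deg sa vg).
Qed.

(* (s u)(t) = u(s t) *)
Definition coext_scale (s : S) (u : coext_sort h M) : coext_sort h M :=
  HomG (coext_scale_subproof s u).

Lemma coext_scaleA r s u :
  coext_scale r (coext_scale s u) = coext_scale (r * s) u.
Proof.
by apply: homG_eq => t /=; congr (homG_fun u); rewrite mulrCA mulrA.
Qed.
Lemma coext_scale1 : left_id 1 coext_scale.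
Proof. by move=> u; apply: homG_eq => t /=; rewrite mul1r. Qed.
Lemma coext_scaleDr : right_distributive coext_scale +%R.
Proof. by move=> s u v; apply: homG_eq. Qed.
Lemma coext_scaleDl u : {morph coext_scale^~ u : r s / r + s}.
Proof.
move=> r s; apply: homG_eq => t; rewrite /= mulrDl.
exact: homGD.
Qed.

HB.instance Definition _ := GRing.Zmodule_isLmodule.Build S (coext_sort h M)
  coext_scaleA coext_scale1 coext_scaleDr coext_scaleDl.

Lemma coext_degZ a g (s : S) (u : coext_sort h M) :
  gr_rdeg a s -> @homG_deg G R hS M g u -> @homG_deg G R hS M (a + g) (s *: u).
Proof. exact: coext_mul_deg. Qed.
End Module.

(* Hom^G_R(h_*(S), M) *)
Definition gr_coext (M : grMod R) : grMod S :=
  @GrMod G S (coext_sort h M) (@homG_deg G R hS M) (@homG_grading G R hS M)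
    (@coext_degZ M).

Section Map.
Variables (M N : grMod R) (f : grHom M N).

Lemma map_deg_comp g (u : hS -> M) :
  map_deg g u -> map_deg g (fun t => f (u t)).
Proof.
move=> /map_degE[ul ud]; apply/map_degE; split=> [r x y|d t td].
  by rewrite ul linearP.
by apply: gr_fun_deg; apply: ud.
Qed.

Lemma coext_map_subproof (u : gr_coext M) :
  (fun t : hS => f (homG_fun u t)) \in @homG_pred G R hS N.
Proof.
have m0 := @map_deg0 G R hS N; have mB := @map_degB G R hS N.
apply/asboolP; apply: (gspan_sub (K := fun u : hS -> M =>
  gspan (@map_deg G R hS N) (fun t : hS => f (u t)))) (homGP u).
- suff -> : (fun t : hS => f ((0 : hS -> M) t)) = 0 by apply: gspan0.
  by apply/funext => t; rewrite linear0.
- move=> v w vs ws; suff -> : (fun t : hS => f ((v + w) t)) =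
      (fun t => f (v t)) + (fun t => f (w t)) by apply: gspanD.
  by apply/funext => t; rewrite !fctE linearD.
by move=> g v vg; apply: gspan1 (map_deg_comp vg).
Qed.

Definition coext_map_fun (u : gr_coext M) : gr_coext N := HomG (coext_map_subproof u).

Lemma coext_map_linear : linear coext_map_fun.
Proof. by move=> s u v; apply: homG_eq => t; apply: (linearD f). Qed.

Lemma coext_map_deg g u :
  gr_deg (gr_coext M) g u -> gr_deg (gr_coext N) g (coext_map_fun u).
Proof. exact: map_deg_comp. Qed.

Definition coext_map : grHom (gr_coext M) (gr_coext N) :=
  GrHom coext_map_linear coext_map_deg.
End Map.

Lemma coext_map_id M : coext_map (idHom M) = idHom (gr_coext M).
Proof. by apply: grHom_eq => u; apply: homG_eq. Qed.

Lemma coext_map_comp L M N (v : grHom M N) (u : grHom L M) :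
  coext_map (compHom v u) = compHom (coext_map v) (coext_map u).
Proof. by apply: grHom_eq => w; apply: homG_eq. Qed.

(* The functor written h with a tilde *)
Definition htilde : grFunctor R S := GrFunctor coext_map_id coext_map_comp.
End Coextension.

(* Main.v *)
Require Import Defs.
From mathcomp Require Import all_boot all_algebra.
From HB Require Import structures.
From mathcomp Require Import boolp functions.

Set Implicit Arguments.
Unset Strict Implicit.
Unset Printing Implicit Defensive.

Import GRing.Theory.
Local Open Scope ring_scope.
Local Open Scope quotient_scope.

(** Given an isomorphism [phi : h^* -> htilde], the identity of [h_*(S)] is the
    image under [phi] of a finite sum of tensors [s_i (x) x_i], hence comes from
    [h^*(F)] for some finite free [F -> h_*(S)]; by naturality the identity then
    factors through [F], so [h_*(S)] is of finite type.  Since [h^*] preserves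
    surjections, so does [htilde], and taking components of degree 0 shows that
    [h_*(S)] is projective.
    Conversely, let [lam : h_*(S) -> R] correspond to 1 under [htilde(R) = S].
    The map [s (x) x |-> (t |-> lam (s t) x)] is natural, and if [(f_i, x_i)] is a
    dual basis of [h_*(S)], then [f_i = lam (s_i * _)] for some [s_i] in [S] and
    [u |-> \sum_i s_i (x) u (x_i)] is its inverse. *)

(** * Graded morphisms, homogeneous components and isomorphisms *)

Section GradedMaps.
Variables (G : zmodType) (R : grRing G) (M N : grMod R) (f : grHom M N).

Lemma gdec_deg (L : grMod R) (x : L) k : gr_deg L k (gdec (gr_grading L) x k).
Proof. by have [s [_ + _ _]] := gdecP (gr_grading L) x; apply. Qed.

(** Applying [f] termwise to the decomposition of [x] yields a decomposition of [f x], and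
    decompositions are unique. *)
Lemma grHom_gdec x k : f (gdec (gr_grading M) x k) = gdec (gr_grading N) (f x) k.
Proof.
have dfx : decomp (gr_deg N) (f x) (fun k => f (gdec (gr_grading M) x k)).
  have [s [us dP d0 xE]] := gdecP (gr_grading M) x.
  exists s; split=> //.
  - by move=> g; apply: gr_fun_deg.
  - by move=> g /d0 ->; rewrite linear0.
  by rewrite {1}xE linear_sum.
exact: (decomp_uniq (gr_grading N) dfx (gdecP _ _)).
Qed.

(** An arbitrary preimage need not be homogeneous, but its component of degree [g] is still a
    preimage, since [f] commutes with components. *)
Lemma grHom_surj_deg g y : (forall y, exists x, y = f x) -> gr_deg N g y ->
  exists2 x, gr_deg M g x & y = f x.
Proof.
move=> fs yg; have [x yE] := fs y.
exists (gdec (gr_grading M) x g); first exact: gdec_deg.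
by rewrite grHom_gdec -yE (gdec_homo _ _ yg) eqxx.
Qed.

Lemma grHom_inj_deg g x : injective f -> gr_deg N g (f x) -> gr_deg M g x.
Proof.
move=> fi xg; suff -> : x = gdec (gr_grading M) x g by apply: gdec_deg.
by apply: fi; rewrite grHom_gdec (gdec_homo _ _ xg) eqxx.
Qed.

(** An injective morphism reflects both linear relations and degrees, so a set-theoretic inverse is
    automatically a graded morphism. Inverses can therefore be supplied below as bare functions. *)
Lemma gr_is_iso_cancel (f' : N -> M) :
  cancel f f' -> cancel f' f -> gr_is_iso f.
Proof.
move=> fK f'K; have fi := can_inj fK.
have ll : linear f'.
  move=> a x y; apply: fi.
  by rewrite f'K linearP /= !f'K.
have dd g x : gr_deg N g x -> gr_deg M g (f' x).
  by move=> xg; apply: grHom_inj_deg => //; rewrite f'K.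
by exists (GrHom ll dd); split; apply: grHom_eq.
Qed.
End GradedMaps.

Section Isomorphisms.
Variables (G : zmodType) (R : grRing G).

Lemma compHomE (L M N : grMod R) (v : grHom M N) (u : grHom L M) w :
  compHom v u = w -> forall x, v (u x) = w x.
Proof. by move=> <- x. Qed.

Lemma gr_isomorphic_sym (M N : grMod R) : gr_isomorphic M N -> gr_isomorphic N M.
Proof. by move=> [u [v [vu uv]]]; exists v, u. Qed.

Lemma gr_isomorphic_trans (L M N : grMod R) :
  gr_isomorphic L M -> gr_isomorphic M N -> gr_isomorphic L N.
Proof.
move=> [u [u' [/compHomE u'u /compHomE uu']]] [v [v' [/compHomE v'v /compHomE vv']]].
exists (compHom v u); apply: (@gr_is_iso_cancel _ _ _ _ _ (compHom u' v')) => x /=.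
  by rewrite v'v /= u'u.
by rewrite uu' /= vv'.
Qed.
End Isomorphisms.

(** * Kernels of graded morphisms *)

Section Kernel.
Variables (G : zmodType) (R : grRing G) (M N : grMod R) (f : grHom M N).

Definition gr_ker_pred : {pred M} := fun x => f x == 0.

Lemma gr_ker_submod_closed : submod_closed gr_ker_pred.
Proof.
split=> [|a x y]; first by rewrite unfold_in linear0.
by rewrite !unfold_in linearP => /eqP xK /eqP yK; rewrite /= xK yK scaler0 addr0.
Qed.

HB.instance Definition _ := GRing.isSubmodClosed.Build R M gr_ker_pred
  gr_ker_submod_closed.

Record gr_ker_sort : Type := GrKer { gr_ker_val :> M; _ : gr_ker_val \in gr_ker_pred }.

HB.instance Definition _ := [isSub for gr_ker_val].
HB.instance Definition _ := [Choice of gr_ker_sort by <:].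
HB.instance Definition _ := [SubChoice_isSubLmodule of gr_ker_sort by <:].

Definition gr_ker_deg (g : G) (x : gr_ker_sort) : Prop := gr_deg M g (gr_ker_val x).

(** The components of an element of the kernel stay in the kernel, because [f] commutes with taking
    components. *)
Lemma gr_ker_grading : is_grading gr_ker_deg.
Proof.
have grM := gr_grading M; split.
- by move=> g; apply: (grading0 grM).
- by move=> g x y; apply: (gradingB grM).
- move=> [x xK]; have [s [_ dP _ xE]] := gdecP (gr_grading M) x.
  have dK g : gdec (gr_grading M) x g \in gr_ker_pred.
    by rewrite unfold_in grHom_gdec (eqP xK : f x = 0) gdec0.
  exists s, (fun g => GrKer (dK g)); split=> //; apply: val_inj.
  by rewrite raddf_sum.
move=> s c us cP c0 k ks; apply: val_inj.
apply: (grading_indep grM us (c := fun k => val (c k))) => //.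
by have := congr1 val c0; rewrite raddf_sum.
Qed.

Lemma gr_ker_degZ a b (r : R) (x : gr_ker_sort) :
  gr_rdeg a r -> gr_ker_deg b x -> gr_ker_deg (a + b) (r *: x).
Proof. exact: gr_degZ. Qed.

Definition gr_ker : grMod R := GrMod gr_ker_grading gr_ker_degZ.

Lemma gr_ker_val_linear : linear (gr_ker_val : gr_ker -> M).
Proof. by []. Qed.

Definition gr_ker_incl : grHom gr_ker M :=
  GrHom gr_ker_val_linear (fun g x xg => xg).

Lemma gr_ker_short_exact :
  (forall y, exists x, y = f x) -> gr_short_exact gr_ker_incl f.
Proof.
move=> fs; split=> //; first exact: val_inj.
move=> y; split=> [y0|[[x xK] ->]]; last exact/eqP.
have yK : y \in gr_ker_pred by apply/eqP.
by exists (GrKer yK).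
Qed.
End Kernel.

(** * Cokernels, and epimorphisms as surjections *)

Section Cokernel.
Variables (G : zmodType) (R : grRing G) (M N : grMod R) (f : grHom M N).

Definition gr_im_pred : {pred N} := fun y => `[< exists x, y = f x >].

Lemma gr_imP y : reflect (exists x, y = f x) (y \in gr_im_pred).
Proof. exact: asboolP. Qed.

Lemma gr_im_zmod_closed : zmod_closed gr_im_pred.
Proof.
split; first by apply/gr_imP; exists 0; rewrite linear0.
by move=> _ _ /gr_imP[x ->] /gr_imP[y ->]; apply/gr_imP; exists (x - y); rewrite linearB.
Qed.

HB.instance Definition _ := GRing.isZmodClosed.Build N gr_im_pred gr_im_zmod_closed.

(** The quotient is taken for the additive group only; the scalar action is then defined through
    representatives. *)
Definition gr_coker_sort : Type := {ideal_quot gr_im_pred}.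
HB.instance Definition _ := GRing.Zmodule.on gr_coker_sort.
HB.instance Definition _ := EqQuotient.on gr_coker_sort.

Definition coker_pi (y : N) : gr_coker_sort := \pi_({ideal_quot gr_im_pred}) y.

Lemma coker_piE y z : coker_pi y = coker_pi z <-> exists x, y - z = f x.
Proof.
rewrite /coker_pi; split=> [/eqP|e].
  by rewrite -Quotient.idealrBE => /gr_imP.
by apply/eqP; rewrite -Quotient.idealrBE; apply/gr_imP.
Qed.

Lemma coker_piB : {morph coker_pi : x y / x - y}.
Proof. by move=> x y; rewrite /coker_pi raddfB. Qed.

Lemma coker_piD : {morph coker_pi : x y / x + y}.
Proof. by move=> x y; rewrite /coker_pi raddfD. Qed.

Lemma coker_pi0 : coker_pi 0 = 0.
Proof. by rewrite /coker_pi raddf0. Qed.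

Lemma coker_pi_surj (q : gr_coker_sort) : exists y, q = coker_pi y.
Proof. by exists (repr q); rewrite /coker_pi; apply/esym/reprK. Qed.

Definition coker_scale (r : R) (q : gr_coker_sort) : gr_coker_sort :=
  coker_pi (r *: repr q).

Lemma coker_scale_pi r y : coker_scale r (coker_pi y) = coker_pi (r *: y).
Proof.
have /coker_piE[x e] : coker_pi (repr (coker_pi y)) = coker_pi y by exact: reprK.
by apply/coker_piE; exists (r *: x); rewrite -scalerBr e linearZ.
Qed.

Lemma coker_scaleA r s q : coker_scale r (coker_scale s q) = coker_scale (r * s) q.
Proof. by have [y ->] := coker_pi_surj q; rewrite !coker_scale_pi scalerA. Qed.
Lemma coker_scale1 : left_id 1 coker_scale.
Proof. by move=> q; have [y ->] := coker_pi_surj q; rewrite coker_scale_pi scale1r. Qed.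
Lemma coker_scaleDr : right_distributive coker_scale +%R.
Proof.
move=> r q p; have [y ->] := coker_pi_surj q; have [z ->] := coker_pi_surj p.
by rewrite -coker_piD !coker_scale_pi scalerDr coker_piD.
Qed.
Lemma coker_scaleDl q : {morph coker_scale^~ q : r s / r + s}.
Proof.
move=> r s; have [y ->] := coker_pi_surj q.
by rewrite !coker_scale_pi scalerDl coker_piD.
Qed.

HB.instance Definition _ := GRing.Zmodule_isLmodule.Build R gr_coker_sort
  coker_scaleA coker_scale1 coker_scaleDr coker_scaleDl.

Definition gr_coker_deg (g : G) (q : gr_coker_sort) : Prop :=
  exists2 y, gr_deg N g y & q = coker_pi y.

Lemma coker_pi_sum (I : Type) (s : seq I) (F : I -> N) :
  coker_pi (\sum_(i <- s) F i) = \sum_(i <- s) coker_pi (F i).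
Proof. by elim/big_rec2: _ => [|i y q _ <-]; rewrite ?coker_pi0 ?coker_piD. Qed.

Lemma gr_coker_grading : is_grading gr_coker_deg.
Proof.
have grN := gr_grading N; split.
- by move=> g; exists 0; [apply: (grading0 grN) | rewrite coker_pi0].
- move=> g _ _ [y yg ->] [z zg ->]; exists (y - z); first exact: (gradingB grN).
  by rewrite coker_piB.
- move=> q; have [y ->] := coker_pi_surj q.
  have [s [c [cP ->]]] := grading_span grN y.
  exists s, (fun g => coker_pi (c g)); split; last exact: coker_pi_sum.
  by move=> g; exists (c g).
move=> s c us cP c0 k ks.
(* Lift each [c g] to a homogeneous [d g] in [N]. The sum of these lifts is some [f x], so [d k] is
   the component of [f x] of degree [k], which is the image of a component of [x]; hence [c k]
   vanishes in the quotient. *)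
pose d g := s2val (cid2 (cP g)).
have dP g : gr_deg N g (d g) by rewrite /d; case: cid2.
have cE g : c g = coker_pi (d g) by rewrite /d; case: cid2.
have /coker_piE[x] : coker_pi (\sum_(g <- s) d g) = coker_pi 0.
  by rewrite coker_pi_sum coker_pi0 -[RHS]c0; apply: eq_bigr.
rewrite subr0 => sE.
have : decomp (gr_deg N) (f x) (fun g => if g \in s then d g else 0).
  exists s; split=> //.
  - by move=> g; case: ifP => // _; apply: (grading0 grN).
  - by move=> g /negbTE ->.
  by rewrite -sE [RHS]big_seq_cond [LHS]big_seq_cond; apply: eq_bigr => g /andP[->].
move=> /(decomp_uniq grN (gdecP (gr_grading N) _))/(_ k); rewrite ks -grHom_gdec => dk.
by rewrite cE -coker_pi0; apply/coker_piE; rewrite subr0 -dk; eexists.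
Qed.

Lemma gr_coker_degZ a b (r : R) (q : gr_coker_sort) :
  gr_rdeg a r -> gr_coker_deg b q -> gr_coker_deg (a + b) (r *: q).
Proof.
move=> ra [y yb ->]; exists (r *: y); first exact: gr_degZ.
exact: coker_scale_pi.
Qed.

Definition gr_coker : grMod R := GrMod gr_coker_grading gr_coker_degZ.

Lemma coker_pi_linear : linear (coker_pi : N -> gr_coker).
Proof. by move=> a x y; rewrite coker_piD -[X in X + _]coker_scale_pi. Qed.

Definition gr_coker_proj : grHom N gr_coker :=
  GrHom coker_pi_linear (fun g y yg => ex_intro2 _ _ y yg erefl).

(** The projection onto the cokernel and the zero map agree after composition with [f]; if [f] is
    epi they are equal, so the cokernel is zero. *)
Lemma gr_is_epiP : gr_is_epi f <-> forall y, exists x, y = f x.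
Proof.
split=> [fe y|fs Q v w vw].
  have /(congr1 (fun u : grHom N gr_coker => u y)) /= : gr_coker_proj = zeroHom N gr_coker.
    apply: fe; apply: grHom_eq => x /=; rewrite -coker_pi0; apply/coker_piE.
    by exists x; rewrite subr0.
  by rewrite -coker_pi0 => /coker_piE[x]; rewrite subr0 => ->; exists x.
by apply: grHom_eq => y; have [x ->] := fs y; apply: (compHomE vw).
Qed.
End Cokernel.

(** * Morphisms out of finite free graded modules *)

Section FreeModules.
Variables (G : zmodType) (R : grRing G) (I : finType) (g : I -> G).

Definition free_basis (i : I) : gr_free R g :=
  [ffun j => if j == i then 1 else 0] : {ffun I -> R^o}.

Lemma free_basis_sum (c : gr_free R g) :
  c = \sum_i ((c : {ffun I -> R^o}) i : R) *: free_basis i.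
Proof.
apply/ffunP => j; rewrite sum_ffunE (bigD1 j) //= !ffunE eqxx big1.
  by rewrite addr0; apply/esym/mulr1.
by move=> i ij; rewrite !ffunE eq_sym (negbTE ij); apply: mulr0.
Qed.

Variables (M : grMod R) (x : I -> M).

Definition free_lift_fun (c : gr_free R g) : M :=
  \sum_i ((c : {ffun I -> R^o}) i : R) *: x i.

Lemma free_lift_linear : linear free_lift_fun.
Proof.
move=> a c d; rewrite /free_lift_fun scaler_sumr -big_split; apply: eq_bigr => i _.
by rewrite !ffunE scalerDl scalerA.
Qed.

(** The sign comes from the shift: the generator 1 of R(g) lies in degree -g, as the part of R(g) in
    degree -g is the degree 0 part of R. *)
Hypothesis x_deg : forall i, gr_deg M (- g i) (x i).

Lemma free_lift_deg k c : gr_deg (gr_free R g) k c -> gr_deg M k (free_lift_fun c).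
Proof.
move=> ck; rewrite /free_lift_fun; elim/big_ind: _ => [|y z yk zk|i _].
- exact: (grading0 (gr_grading M)).
- exact: (gradingD (gr_grading M)).
by have := gr_degZ (ck i : gr_rdeg (g i + k) _) (x_deg i); rewrite addrAC subrr add0r.
Qed.

Definition free_lift : grHom (gr_free R g) M := GrHom free_lift_linear free_lift_deg.

Lemma free_lift_basis i : free_lift (free_basis i) = x i.
Proof.
rewrite /= /free_lift_fun (bigD1 i) //= ffunE eqxx scale1r big1 ?addr0 // => j ji.
by rewrite ffunE (negbTE ji) scale0r.
Qed.
End FreeModules.

(** * Finite type, projectivity and dual bases *)

Lemma gr_finite_typeP (G : zmodType) (R : grRing G) (M : grMod R) :
  gr_finite_type M <-> exists (I : finType) (g : I -> G) (p : grHom (gr_free R g) M),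
    forall y, exists x, y = p x.
Proof.
split=> [[I [g [L [u [[a [b [/compHomE ba _]]] /gr_is_epiP us]]]]]|[I [g [p /gr_is_epiP pe]]]].
  exists I, g, (compHom u b) => y; have [x ->] := us y; exists (a x).
  by rewrite /= ba.
exists I, g, (gr_free R g), p; split=> //.
by exists (idHom _), (idHom _); split; apply: grHom_eq.
Qed.

(** Exactness of Hom(N, -) on 0 -> ker p -> M -> N -> 0 lifts the identity of [N]. *)
Lemma gr_projective_section (G : zmodType) (R : grRing G) (M N : grMod R)
    (p : grHom M N) :
  gr_projective N -> (forall y, exists x, y = p x) ->
  exists s : grHom N M, forall y, p (s y) = y.
Proof.
move=> Np ps; have [_ _ /(_ (idHom N))[s e]] := Np _ _ _ _ _ (gr_ker_short_exact ps).
by exists s => y; rewrite (compHomE (esym e)).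
Qed.

(** Left exactness of Hom(M, -) holds for every [M]: a map killed by [g] factors pointwise through
    [f], and injectivity of [f] makes the factor linear and degree-preserving. Only lifting along
    surjections remains. *)
Lemma gr_projective_lift (G : zmodType) (R : grRing G) (M : grMod R) :
  (forall (B C : grMod R) (p : grHom B C), (forall y, exists x, y = p x) ->
   forall w : grHom M C, exists v : grHom M B, w = compHom p v) ->
  gr_projective M.
Proof.
move=> Ml A B C f g [fi fg gs]; split=> [u v /compHomE e|v|w]; last exact: Ml.
  by apply: grHom_eq => x; apply: fi; rewrite e.
split=> [/compHomE gv|[u ->]]; last first.
  by apply: grHom_eq => x /=; apply/fg; exists (u x).
have fv x : exists y, v x = f y by apply/fg; rewrite gv.
pose u x := sval (cid (fv x)).
have fu x : f (u x) = v x by rewrite /u; case: cid.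
have ul : linear u by move=> a x y; apply: fi; rewrite fu !linearP /= !fu.
have ud k x : gr_deg M k x -> gr_deg A k (u x).
  by move=> xk; apply: (grHom_inj_deg (f := f)) => //; rewrite fu; apply: gr_fun_deg.
by exists (GrHom ul ud); apply: grHom_eq => x /=; rewrite fu.
Qed.

(** Split a surjection from a finite free module: the coordinates of the section are the
    functionals, and the images of the basis vectors are the elements [x i]. *)
Lemma gr_dual_basis (G : zmodType) (R : grRing G) (M : grMod R) :
  gr_projective M -> gr_finite_type M ->
  exists (I : finType) (f : I -> homG M (gr_reg R)) (x : I -> M),
    forall y, y = \sum_i (f i y : R) *: x i.
Proof.
move=> Mp /gr_finite_typeP[I [g [p ps]]].
have [s sK] := gr_projective_section Mp ps.
pose F i (y : M) : gr_reg R := (s y : {ffun I -> R^o}) i.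
have FP i : map_deg (M := M) (N := gr_reg R) (g i) (F i).
  apply/map_degE; split=> [a x y|d x xd]; first by rewrite /F linearP !ffunE.
  exact: (gr_fun_deg s xd).
have FH i : F i \in homG_pred (M := M) (N := gr_reg R).
  by apply/asboolP; apply: gspan1 (FP i); apply: map_deg0.
exists I, (fun i => HomG (FH i)), (fun i => p (free_basis R g i)) => y.
rewrite -{1}[y]sK {1}[s y]free_basis_sum linear_sum.
by apply: eq_bigr => i _; rewrite linearZ.
Qed.

(** * Graded homomorphisms of rank one *)

Section RankOne.
Variables (G : zmodType) (R : grRing G) (L M : grMod R).

Lemma rank_one_deg a b (u : L -> gr_reg R) (x : M) :
  map_deg a u -> gr_deg M b x -> map_deg (a + b) (fun t => (u t : R) *: x).
Proof.
move=> /map_degE[ul ud] xb; apply/map_degE; split=> [r s t|d t td].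
  by rewrite ul scalerDl scalerA.
by rewrite addrAC; apply: gr_degZ xb; apply: ud.
Qed.

(** The expression is additive in [x] and in [u], which reduces the claim to homogeneous [x] and
    [u], where the degrees add up. *)
Lemma rank_one_subproof (u : homG L (gr_reg R)) (x : M) :
  (fun t : L => (u t : R) *: x) \in homG_pred (M := L) (N := M).
Proof.
have m0 := @map_deg0 G R L M; have mB := @map_degB G R L M.
apply/asboolP; elim/(grading_ind (gr_grading M)): x => [|x y IHx IHy|b x xb].
- suff -> : (fun t => (u t : R) *: (0 : M)) = 0 by apply: gspan0.
  by apply/funext => t; rewrite scaler0.
- suff -> : (fun t => (u t : R) *: (x + y)) =
      (fun t => (u t : R) *: x) + (fun t => (u t : R) *: y) by apply: gspanD.
  by apply/funext => t; rewrite scalerDr.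
apply: (gspan_sub (K := fun u : L -> gr_reg R =>
  gspan (map_deg (M := L) (N := M)) (fun t => (u t : R) *: x))) (homGP u).
- suff -> : (fun t : L => ((0 : L -> gr_reg R) t : R) *: x) = 0 by apply: gspan0.
  by apply/funext => t; apply: scale0r.
- move=> v w vs ws; suff -> : (fun t : L => ((v + w) t : R) *: x) =
      (fun t => (v t : R) *: x) + (fun t => (w t : R) *: x) by apply: gspanD.
  by apply/funext => t; apply: scalerDl.
by move=> a v va; apply: gspan1 (rank_one_deg va xb).
Qed.

Definition rank_one (u : homG L (gr_reg R)) (x : M) : homG L M :=
  HomG (rank_one_subproof u x).
End RankOne.

(** * The comparison morphism attached to a linear form of degree 0 *)

Section Comparison.
Variables (G : zmodType) (R S : grRing G) (h : grRingHom R S).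
Local Notation hS := (gr_res h (gr_reg S)).
Variable lam : homG hS (gr_reg R).
Hypothesis lam_deg : homG_deg 0 lam.

Let form (s : S) : R := lam s.

Let formD s t : form (s + t) = form s + form t.
Proof. exact: (homGD lam (s : hS) (t : hS)). Qed.

Let formZ r s : form (h r * s) = r * form s.
Proof. exact: (linearZ_LR lam r (s : hS)). Qed.

Let form_sum (I : finType) (c : I -> R) (t : I -> S) :
  form (\sum_i h (c i) * t i) = \sum_i c i * form (t i).
Proof.
elim/big_rec2: _ => [|i y z _ <-]; last by rewrite formD formZ.
exact: (homG0 lam).
Qed.

Lemma coext_sumE (M : grMod R) (I : Type) (r : seq I) (F : I -> gr_coext h M) (t : hS) :
  homG_fun (\sum_(i <- r) F i) t = \sum_(i <- r) homG_fun (F i) t.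
Proof. by elim/big_rec2: _ => // i y z _ <-. Qed.

Section Object.
Variable M : grMod R.

Definition comparison_pairing (s : hS) (x : M) : gr_coext h M :=
  rank_one (coext_scale (s : S) lam) x.

Lemma comparison_pairingE s x t :
  homG_fun (comparison_pairing s x) t = form ((s : S) * (t : S)) *: x.
Proof. by []. Qed.

Lemma comparison_pairing_balanced : balanced comparison_pairing.
Proof.
split=> [x s s'|s x y|r s x]; apply: homG_eq => t; rewrite !comparison_pairingE.
- by rewrite mulrDl formD scalerDl.
- exact: scalerDr.
have -> : (r *: s : hS) * (t : S) = h r * ((s : S) * (t : S)) :> S by rewrite mulrA.
by rewrite formZ scalerA [in RHS]mulrC.
Qed.

Definition comparison_fun : gr_ext h M -> gr_coext h M := tlift comparison_pairing.

Lemma comparison_tens s x : comparison_fun (tens s x) = comparison_pairing s x.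
Proof. exact: (tlift_tens _ _ comparison_pairing_balanced). Qed.

Lemma comparisonD z w : comparison_fun (z + w) = comparison_fun z + comparison_fun w.
Proof. exact: (tliftD _ _ comparison_pairing_balanced). Qed.

Lemma comparison0 : comparison_fun 0 = 0.
Proof. exact: (tlift0 comparison_pairing_balanced). Qed.

Lemma comparison_scale s (z : ext_sort h M) :
  comparison_fun (ext_scale s z) = coext_scale s (comparison_fun z).
Proof.
elim/tensor_ind: z => [|t x z IHz].
  by rewrite ext_scale0 comparison0; apply: homG_eq.
rewrite ext_scaleDr !comparisonD coext_scaleDr IHz ext_scale_tens !comparison_tens.
congr (_ + _); apply: homG_eq => t' /=; congr (form _ *: _).
by rewrite mulrCA mulrA.
Qed.

Lemma comparison_linear : linear comparison_fun.
Proof. by move=> s z w; rewrite comparisonD comparison_scale. Qed.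

Lemma comparison_deg g z :
  gr_deg (gr_ext h M) g z -> gr_deg (gr_coext h M) g (comparison_fun z).
Proof.
have grC := gr_grading (gr_coext h M).
elim=> [|a b s x {}z sa xb <- _ IHz]; first by rewrite comparison0; apply: (grading0 grC).
rewrite comparisonD comparison_tens; apply: (gradingD grC) => //.
(* Since [lam] has degree 0, multiplying it by [s] gives a functional of the same degree [a] as
   [s]. *)
apply: rank_one_deg xb; rewrite -[a]addr0; exact: coext_mul_deg sa lam_deg.
Qed.

Definition comparison : grHom (gr_ext h M) (gr_coext h M) :=
  GrHom comparison_linear comparison_deg.
End Object.

Lemma comparison_natural (M N : grMod R) (u : grHom M N) :
  compHom (comparison N) (fmap (hstar h) u) = compHom (fmap (htilde h) u) (comparison M).
Proof.
apply: grHom_eq; elim/tensor_ind => [|s x z IHz].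
  by rewrite !linear0.
rewrite !linearD; congr (_ + _); last exact: IHz.
rewrite /= ext_map_tens !comparison_tens; apply: homG_eq => t /=.
by rewrite linearZ.
Qed.

(* A dual basis of the form [(lam (s i * _), x i)] turns [u] into
   [\sum_i s i (x) u (x i)], which inverts the comparison map. *)
Lemma comparison_iso (I : finType) (s x : I -> S) (M : grMod R) :
  (forall t t' : S, (forall y, form (t * y) = form (t' * y)) -> t = t') ->
  (forall y : S, y = \sum_i h (form (s i * y)) * x i) ->
  gr_is_iso (comparison M).
Proof.
move=> lam_inj basis.
have bT : balanced (@tens R hS M) := tens_balanced hS M.
pose inv (u : gr_coext h M) : gr_ext h M :=
  \sum_i tens (s i : hS) (homG_fun u (x i : hS)).
have basisL y : (y : hS) = \sum_i form (s i * y) *: (x i : hS) by exact: basis.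
(* Evaluated at [t], this is the expansion of [t] in the dual basis, pushed through the linear map
   [u]. *)
have invK : cancel inv (comparison M).
  move=> u; rewrite linear_sum; apply: homG_eq => t; rewrite coext_sumE.
  rewrite [in RHS](basisL t) linear_sum; apply: eq_bigr => i _.
  by rewrite /= comparison_tens linearZ.
apply: (gr_is_iso_cancel (f' := inv)) => //.
have invD u v : inv (u + v) = inv u + inv v.
  by rewrite -big_split; apply: eq_bigr => i _; exact: (balancedDr bT).
elim/tensor_ind => [|t y z IHz].
  by rewrite linear0 /inv big1 // => i _; apply: (balanced0r bT).
rewrite linearD invD; congr (_ + _); last exact: IHz.
(* The roles of [s] and [x] can be exchanged. By nondegeneracy it suffices to pair both sides with
   an arbitrary [t']; expanding [t'] in the given basis turns both into the sum of the products
   [form (t * x i) * form (s i * t')]. The scalars [form (t * x i)] can then be moved across the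
   tensor sign to recover [t]. *)
have tE : (t : S) = \sum_i h (form (t * x i)) * s i.
  apply: lam_inj => t'; rewrite {1}[t']basis mulr_sumr mulr_suml.
  under eq_bigr do rewrite mulrCA.
  rewrite form_sum; under [in RHS]eq_bigr do rewrite -mulrA.
  by rewrite form_sum; apply: eq_bigr => i _; rewrite mulrC.
rewrite /= comparison_tens /inv.
transitivity (tens (\sum_i form (t * x i) *: (s i : hS)) y : gr_ext h M); last first.
  by congr tens; rewrite [RHS]tE.
transitivity (\sum_i tens (form (t * x i) *: (s i : hS)) y : gr_ext h M).
  by apply: eq_bigr => i _; rewrite (balancedZ bT).
by elim/big_rec2: _ => [|i v w _ ->]; rewrite ?(balanced0l bT) ?(balancedDl bT).
Qed.
End Comparison.

(** The shift of [N] by 0 is not literally [N], so degree 0 elements of the graded Hom have to be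
    converted into morphisms. *)
Lemma map_degree0P (G : zmodType) (R : grRing G) (M N : grMod R) (u : M -> N) :
  map_deg 0 u <-> exists v : grHom M N, u = v.
Proof.
split=> [/map_degE[ul ud]|[v ->]]; last first.
  apply/map_degE; split=> [|d x xd]; first exact: gr_fun_linear.
  by rewrite add0r; apply: gr_fun_deg.
have ud' d x : gr_deg M d x -> gr_deg N d (u x) by move=> /ud; rewrite add0r.
by exists (GrHom ul ud').
Qed.

(** * Extension of scalars: value at the base ring, surjections, reduction to free modules *)

Section Extension.
Variables (G : zmodType) (R S : grRing G) (h : grRingHom R S).
Local Notation hS := (gr_res h (gr_reg S)).

(** Linearity and degrees are checked on [s] |-> [s] (x) 1 only; its inverse, induced by [s] (x) [r]
    |-> [h r * s], is needed merely as a function. *)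
Lemma ext_reg_isomorphic : gr_isomorphic (gr_ext h (gr_reg R)) (gr_reg S).
Proof.
have bT : balanced (@tens R hS (gr_reg R)) := tens_balanced hS (gr_reg R).
pose o : gr_reg R := (1 : R).
pose v (s : gr_reg S) : gr_ext h (gr_reg R) := tens (s : hS) o.
have vl : linear v.
  by move=> a s t; rewrite /v (balancedDl bT); congr (_ + _); apply/esym/ext_scale_tens.
have vd g s : gr_deg (gr_reg S) g s -> gr_deg (gr_ext h (gr_reg R)) g (v s).
  by move=> sg; rewrite -[g]addr0; apply: tensor_deg_tens => //; apply: gr_rdeg1.
pose b (s : hS) (r : gr_reg R) : S := h r * (s : S).
have bb : balanced b.
  split=> [r s t|s q r|q s r]; rewrite /b.
  - exact: mulrDr.
  - by rewrite rmorphD mulrDl.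
  by rewrite [h (q *: r)]rmorphM mulrA; congr (_ * _); apply: mulrC.
apply: gr_isomorphic_sym; exists (GrHom vl vd).
apply: (@gr_is_iso_cancel _ _ _ _ (GrHom vl vd) (tlift b : _ -> gr_reg S)) => [s|] /=.
  by rewrite /v tlift_tens // /b rmorph1 mul1r.
elim/tensor_ind => [|s r z IHz]; first by rewrite tlift0 // /v (balanced0l bT).
rewrite tliftD // -[X in _ = _ + X]IHz /v (balancedDl bT) tlift_tens //; congr (_ + _).
rewrite -[b s r]/((r : R) *: s) (balancedZ bT); congr tens; exact: mulr1.
Qed.

(** Preimages are built tensor by tensor, lifting only the second factor. *)
Lemma ext_map_surj (M N : grMod R) (p : grHom M N) :
  (forall y, exists x, y = p x) ->
  forall z : gr_ext h N, exists z', z = ext_map h p z'.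
Proof.
move=> ps; elim/tensor_ind => [|s y z [z' ->]]; first by exists 0; rewrite linear0.
have [x ->] := ps y; exists (tens s x + z').
by rewrite linearD; congr (_ + _); apply/esym/ext_map_tens.
Qed.

(** The degree of each second factor is recorded because it dictates a shift of the free module
    built next; the first factors may be arbitrary. *)
Lemma ext_homogeneous_tensors (M : grMod R) (z : gr_ext h M) :
  exists l : seq (hS * {q : G * M | gr_deg M q.1 q.2}),
    z = \sum_(q <- l) tens q.1 (sval q.2).2.
Proof.
have bT : balanced (@tens R hS M) := tens_balanced hS M.
elim/tensor_ind: z => [|s x z [l zE]]; first by exists [::]; rewrite big_nil.
suff [m ->] : exists l : seq (hS * {q : G * M | gr_deg M q.1 q.2}),
    tens s x = \sum_(q <- l) tens q.1 (sval q.2).2.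
  by exists (m ++ l); rewrite big_cat zE.
elim/(grading_ind (gr_grading M)): x => [|x y [m xE] [n yE]|g x xg].
- by exists [::]; rewrite big_nil (balanced0r bT).
- by exists (m ++ n); rewrite big_cat (balancedDr bT) xE yE.
pose q : {q : G * M | gr_deg M q.1 q.2} := exist _ (g, x) xg.
by exists [:: (s, q)]; rewrite big_seq1.
Qed.

Lemma ext_from_free (M : grMod R) (z : gr_ext h M) :
  exists (I : finType) (g : I -> G) (p : grHom (gr_free R g) M) z',
    z = ext_map h p z'.
Proof.
have [l zE] := ext_homogeneous_tensors z.
pose q (i : 'I_(size l)) := tnth (in_tuple l) i.
have qd i : gr_deg M (- - (sval (q i).2).1) (sval (q i).2).2.
  by rewrite opprK; apply: (svalP (q i).2).
(* One generator for each tensor, shifted by minus the degree of its second factor, so that the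
   basis vector and its image have the same degree. *)
exists 'I_(size l), (fun i => - (sval (q i).2).1), (free_lift qd).
exists (\sum_i tens (q i).1 (free_basis R _ i) : gr_ext h _).
rewrite linear_sum zE big_tnth; apply: eq_bigr => i _.
by rewrite /= ext_map_tens -[X in tens _ X](free_lift_basis qd).
Qed.
End Extension.

(** * Consequences of an isomorphism of functors *)

Section Necessity.
Variables (G : zmodType) (R S : grRing G) (h : grRingHom R S).
Local Notation hS := (gr_res h (gr_reg S)).
Hypothesis iso : functors_isomorphic (hstar h) (htilde h).

(** Extension of scalars preserves surjections, and naturality of the isomorphism carries this over
    to coextension. *)
Lemma coext_map_surj (M N : grMod R) (p : grHom M N) :
  (forall y, exists x, y = p x) ->
  forall v : gr_coext h N, exists u, v = coext_map h p u.
Proof.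
have [phi [phi_iso nat]] := iso; move=> ps v.
have [w [_ /compHomE /(_ v) /= <-]] := phi_iso N.
have [z ->] := ext_map_surj ps (w v); exists (phi M z).
exact: (compHomE (nat _ _ p)).
Qed.

Lemma homG_of_grHom (M : grMod R) (u : grHom hS M) :
  exists2 v : gr_coext h M, gr_deg (gr_coext h M) 0 v & homG_fun v = u.
Proof.
have u0 : map_deg 0 u by apply/map_degree0P; exists u.
have uP : gr_fun u \in @homG_pred G R hS M.
  by apply/asboolP; apply: gspan1 u0; apply: map_deg0.
by exists (HomG uP).
Qed.

Lemma iso_projective : gr_projective hS.
Proof.
apply: gr_projective_lift => B C p ps w.
have [W W0 WE] := homG_of_grHom w.
(* Regarded as an element of degree 0, [w] has a preimage under the surjection induced by [p]; this
   can be chosen of degree 0 and is then a morphism lifting [w]. *)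
have [V /map_degree0P[v vE] WV] := grHom_surj_deg (coext_map_surj ps) W0.
exists v; apply: grHom_eq => t; rewrite -WE WV /=.
exact: (congr1 (fun k : hS -> B => p (k t)) vE).
Qed.

Lemma iso_finite_type : gr_finite_type hS.
Proof.
have [phi [phi_iso nat]] := iso.
have [W _ WE] := homG_of_grHom (idHom hS).
have [w [_ /compHomE /(_ W) /= wK]] := phi_iso hS.
have [I [g [p [z zE]]]] := ext_from_free (w W).
(* By naturality, [p] composed with [phi _ z] is the image under [phi] of [w W], that is, the
   identity; so [phi _ z] evaluated at [t] is a preimage of [t]. *)
apply/gr_finite_typeP; exists I, g, p => t; exists (homG_fun (phi _ z) t).
rewrite -[LHS]/(idHom hS t) -WE -wK zE.
exact: (congr1 (fun v : gr_coext h hS => homG_fun v t) (compHomE (nat _ _ p) z)).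
Qed.

Lemma iso_coext_reg : gr_isomorphic (gr_coext h (gr_reg R)) (gr_reg S).
Proof.
have [phi [phi_iso _]] := iso.
apply: gr_isomorphic_trans (ext_reg_isomorphic h); apply: gr_isomorphic_sym.
exists (phi (gr_reg R)); exact: phi_iso.
Qed.
End Necessity.

(** * Construction of the isomorphism of functors *)

Lemma coext_isomorphic_ext (G : zmodType) (R S : grRing G) (h : grRingHom R S) :
  gr_projective (gr_res h (gr_reg S)) -> gr_finite_type (gr_res h (gr_reg S)) ->
  gr_isomorphic (gr_coext h (gr_reg R)) (gr_reg S) ->
  functors_isomorphic (hstar h) (htilde h).
Proof.
move=> Sp Sf [theta [psi [/compHomE thetaK /compHomE psiK]]].
have [I [f [x basis]]] := gr_dual_basis Sp Sf.
pose o : gr_reg S := (1 : S); pose lam := psi o.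
(* By S-linearity, [psi] is determined by its value [lam] at 1. *)
have psiE (s : S) (t : S) : homG_fun (psi s) t = homG_fun lam (s * t : S).
  have so : s *: o = s by exact: mulr1.
  have psiZ : psi (s *: o) = coext_scale s lam by exact: linearZ_LR.
  by rewrite so in psiZ; rewrite psiZ.
have lam_deg : homG_deg 0 lam by apply: (gr_fun_deg psi); apply: gr_rdeg1.
exists (fun M => comparison lam_deg M); split=> [M|M N u]; last exact: comparison_natural.
(* Since [psi] inverts [theta], the functional [f i] is [lam] multiplied by [theta (f i)].
   Nondegeneracy of [lam] is the injectivity of [psi]. *)
apply: (comparison_iso lam_deg (s := fun i => theta (f i)) (x := x)) => [t t' tt'|y].
  have /(congr1 theta) : psi t = psi t' by apply: homG_eq => y; rewrite (psiE t) (psiE t') tt'.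
  by rewrite !psiK.
rewrite [LHS](basis y); apply: eq_bigr => i _.
by rewrite -psiE thetaK.
Qed.

Theorem mainTheorem9 (G : zmodType) (R S : grRing G) (h : grRingHom R S) :
  functors_isomorphic (hstar h) (htilde h) <->
  (gr_projective (gr_res h (gr_reg S)) /\ gr_finite_type (gr_res h (gr_reg S)) /\
   gr_isomorphic (htilde h (gr_reg R)) (gr_reg S)).
Proof.
split=> [iso|[Sp [Sf Si]]]; last exact: coext_isomorphic_ext.
split; first exact: iso_projective.
by split; [apply: iso_finite_type | apply: iso_coext_reg].
Qed.
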